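(* Let $G$ be a finite group and let $N$ be a normal subgroup of $G$. Suppose that all elements of $G \setminus N$ have prime power order, and that there are two distinct primes $p$ and $q$ such that the set of primes dividing the order of some element of $G \setminus N$ is exactly $\{p, q\}$. Then $G$ is a $\{p,q\}$-group, and $G/N$ is either a Frobenius group or a $2$-Frobenius group.
   Context: All groups are finite. A $\{p,q\}$-group is a group whose order is divisible by no primes other than $p$ and $q$. A proper, nontrivial subgroup $H$ of a group $G$ is a Frobenius complement if $H \cap H^g = 1$ for all $g \in G \setminus H$ (where $H^g = g^{-1}Hg$); $G$ is a Frobenius group if it contains a Frobenius complement $H$, and then its Frobenius kernel is the normal subgroup $G \setminus \bigcup_{g \in G} (H \setminus \{1\})^g$. A group $G$ is a $2$-Frobenius group if there exist normal subgroups $K < L < G$ of $G$ such that $G/K$ and $L$ are Frobenius groups with Frobenius kernels $L/K$ and $K$, respectively. *)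

(* Defs.v *)
From mathcomp Require Import all_boot all_fingroup all_solvable all_character.

Set Implicit Arguments.
Unset Strict Implicit.
Unset Printing Implicit Defensive.

Import GroupScope.

Definition two_Frobenius (gT : finGroupType) (G : {group gT}) : Prop :=
  exists K L : {group gT},
    [/\ K <| G, L <| G, K \proper L & L \proper G] /\
    [Frobenius G / K with kernel L / K] /\ [Frobenius L with kernel K].

Definition prime_power_order (gT : finGroupType) (x : gT) : Prop :=
  exists r k : nat, prime r /\ #[x] = (r ^ k)%N.

(* The next two lemmas relate the library's Frobenius predicates to the        *)
(* textbook definitions: a complement is a proper nontrivial subgroup meeting  *)
(* its other conjugates trivially, and the kernel is what remains of G once    *)
(* the nontrivial elements of the conjugates of the complement are removed.    *)
Lemma Frobenius_complementP (gT : finGroupType) (G H : {group gT}) :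
  [Frobenius G with complement H] <->
  [/\ H :!=: 1, H \proper G & {in G :\: H, forall g, H :&: H :^ g = 1}].
Proof.
split=> [/andP[neqHG tiHG] | [ntH /properP[sHG [y Gy nHy]] tiH]].
  have [ntH sHG tiH] := normedTI_memJ_P tiHG.
  split; first by move: ntH; rewrite setD_eq0 subG1.
    by rewrite properEneq neqHG.
  move=> g /setDP[Gg nHg]; apply/trivgP/subsetP=> x /setIP[Hx].
  case/imsetP=> z Hz Dx; rewrite inE; apply: contraR nHg => ntx.
  have ntz: z != 1 by apply: contra ntx => /eqP z1; rewrite Dx z1 conj1g.
  by rewrite -(tiH z g) ?inE ?ntz // -Dx ntx.
rewrite /Frobenius_group_with_complement; apply/andP; split.
  by apply: contraNneq nHy => ->.
apply/normedTI_memJ_P; split=> //; first by rewrite setD_eq0 subG1.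
move=> a g /setD1P[nta Ha] Gg; rewrite !inE conjg_eq1 nta /=.
apply/idP/idP=> [Hag | Hg]; last by rewrite groupJ.
apply: contraR nta => nHg; rewrite -(conjg_eq1 a g); apply/eqP/set1gP.
by rewrite -(tiH g) ?inE ?nHg // Hag memJ_conjg.
Qed.

Lemma Frobenius_kernelP (gT : finGroupType) (G K : {group gT}) :
  [Frobenius G with kernel K] <->
  exists2 H : {group gT}, [Frobenius G with complement H]
    & K :=: G :\: \bigcup_(g in G) H^# :^ g.
Proof.
have kerE (L H : {group gT}) :
  [Frobenius G = L ><| H] -> L :=: G :\: \bigcup_(g in G) H^# :^ g.
  move=> frobG; have [/eqP defG /andP[_ tiHG]] := andP frobG.
  have [_ sHG tiH] := normedTI_memJ_P tiHG.
  have [_ mulLH nLH tiLH] := sdprodP defG.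
  have nsLG: L <| G by have [] := sdprod_context defG.
  have [/eqP covG _ _] := and3P (Frobenius_partition frobG).
  apply/setP=> x; rewrite inE.
  apply/idP/andP=> [Lx | [nHx]].
    split; last by apply: (subsetP (normal_sub nsLG)).
    apply/bigcupP=> [[g Gg /imsetP[h /setD1P[nth Hh] Dx]]].
    case/eqP: nth; apply/set1gP; rewrite -tiLH inE Hh andbT.
    by rewrite -(memJ_norm h (subsetP (normal_norm nsLG) g Gg)) -Dx.
  rewrite -covG => /bigcupP[_ /setU1P[-> // | /imsetP[g Lg ->]] Hx].
  case/bigcupP: nHx; exists g => //.
  exact: subsetP (normal_sub nsLG) g Lg.
split=> [/existsP[H frobG] | [H frobG defK]].
  by exists H; [case/andP: frobG | apply: kerE].
have [L frobL] := Frobenius_kernel_exists frobG.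
apply/existsP; exists H; suffices ->: K = L by [].
by apply/group_inj; rewrite defK -(kerE L H).
Qed.

(* Main.v *)
Require Import Defs.
From mathcomp Require Import all_boot all_fingroup all_solvable.
From mathcomp Require Import ssralg integral_char.
Import GroupScope FiniteModule.

(** Write Q for G / N. An element of G outside N is a p-element or a q-element,
    and both kinds occur. Hence Q is a {p,q}-group, solvable by Burnside, in
    which every element has prime power order (an EPPO group), and which is
    neither a p-group nor a q-group. Two independent facts remain.

    Structure of Q ([solvable_EPPO_Frobenius], due to Higman). In an EPPO group
    the centralizer of a nontrivial s-element is an s-group, so a normal Hall
    s-subgroup that is proper and nontrivial is a Frobenius kernel. Solvability
    gives a prime s with K = 'O_s(Q) nontrivial. If Q / K is an s'-group, then
    Q is Frobenius with kernel K. Otherwise let L / K = 'O_t(Q / K) be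
    nontrivial; then t differs from s, L is Frobenius with kernel K, and L / K,
    being a t-group isomorphic to a Frobenius complement, has rank at most 1.
    An element of order s of Q / K fixes only 1 in L / K; this excludes
    t = 2, as L / K would then contain a unique, hence fixed, central
    involution. So t is odd, L / K is cyclic, its automorphism group is
    abelian, and (Q / K) / (L / K) is an abelian EPPO group with s-elements,
    that is, an s-group. Thus Q / K is Frobenius with kernel L / K.

    Primes dividing the order of N ([prime_dvd_normal_outside]). Suppose that a
    prime r divides #|N| but not the order of any element outside N. By the
    Frattini argument, replacing G and N by the normalizers in them of a Sylow
    r-subgroup R of N changes neither the hypotheses nor, up to isomorphism, Q,
    so R may be taken normal in G. Every element outside N then acts on R
    without nontrivial fixed points. Starting from some nontrivial 'O_s(Q), one
    finds in G a Frobenius group P ><| <[x]>, with P an s-group not contained in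
    N and x an element of prime order outside N. Neither P nor x has a
    nontrivial fixed point in the abelian group 'Z(R), whose order is coprime to
    #|P|; by [Frobenius_fixpoint] this forces 'Z(R) = 1, a contradiction.

    That last fact, and the bound on the rank of a Frobenius complement, are
    both instances of one counting argument for groups that are partitioned
    into subgroups ([partitioned_group_fixpoint]). *)

Set Implicit Arguments.
Unset Strict Implicit.
Unset Printing Implicit Defensive.

(** * Fixed points of partitioned groups *)

Section FixedPoints.

Variable gT : finGroupType.
Implicit Types A G H K B E : {group gT}.

(** The sum of the translates of u under B is fixed by B. *)
Lemma sum_actr_group_eq0 A B (abA : abelian A) (u : fmod_of abA) :
  B \subset 'N(A) -> 'C_A(B) = 1 -> (\sum_(b in B) actr u b = 0)%R.
Proof.
move=> nAB tiAB; set w := (\sum_(b in B) _)%R.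
apply: val_inj; apply/set1gP; rewrite -tiAB inE fmodP /=.
apply/centP=> c Bc; apply/commgP/conjg_fixP.
rewrite -fmvalJ ?(subsetP nAB) //; congr (val _).
rewrite /w (actr_sum c) /= [RHS](reindex_inj (mulIg c)) /=.
apply: eq_big => b; first by rewrite groupMr.
by move=> Bb; rewrite actrM ?(subsetP nAB).
Qed.

(** View A as an H-module. For u in A the sum of the u ^ x over the nontrivial
    x in H is - u, because the full sum is a fixed point; grouping the terms
    according to the part of PP that contains x gives - #|PP| u instead. *)
Lemma partitioned_group_fixpoint A H (PP : {set {set gT}}) :
    abelian A -> H \subset 'N(A) ->
    {in PP, forall B : {set gT}, [/\ group_set B, B \subset H & 'C_A(B) = 1]} ->
    {in H^#, forall x, #|[set B in PP | x \in B]| = 1%N} ->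
    PP != set0 -> coprime #|A| #|PP|.-1 ->
  A :=: 1.
Proof.
move=> abA nAH grPP covPP ntPP coA.
have tiAH : 'C_A(H) = 1.
  have [B PPB] := set0Pn _ ntPP; have [_ sBH tiAB] := grPP B PPB.
  by apply/trivgP; rewrite -tiAB setIS ?centS.
have kill (u : fmod_of abA) : (u *+ #|PP|.-1 = 0)%R.
  have sumB (B : {set gT}) : B \in PP -> (\sum_(x in B^#) actr u x = - u)%R.
    case/grPP=> gB sBH tiAB; apply/eqP; rewrite -GRing.addr_eq0; apply/eqP.
    have nAB := subset_trans sBH nAH.
    have /= := @sum_actr_group_eq0 _ (Group gB) abA u nAB tiAB.
    by rewrite (big_setD1 1) ?(group1 (Group gB)) //= actr1 GRing.addrC.
  have := @sum_actr_group_eq0 _ H abA u nAH tiAH.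
  rewrite (big_setD1 1) //= actr1.
  (* Exchange the sums: each nontrivial x is counted in exactly one part. *)
  have ->: (\sum_(x in H^#) actr u x =
            \sum_(B in PP) \sum_(x in B^#) actr u x)%R.
    under [in RHS]eq_bigr do rewrite big_mkcond.
    rewrite exchange_big /= big_mkcond /=; apply: eq_bigr => x _.
    rewrite -big_mkcondr /= GRing.sumr_const; case: ifP => Hx.
      rewrite -[LHS]GRing.mulr1n; congr (_ *+ _)%R.
      rewrite -(covPP x Hx); apply: eq_card => B; rewrite !inE.
      by rewrite [RHS]unfold_in in_setD1; case/setD1P: Hx => -> _.
    rewrite (_ : #|_| = 0%N) ?GRing.mulr0n //; apply: eq_card0 => B.
    rewrite [LHS]unfold_in in_setD1; apply/and3P=> [[PPB ntx Bx]].
    case/negP: (negbT Hx).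
    by rewrite !inE ntx; case: (grPP B PPB) => _ /subsetP->.
  rewrite (eq_bigr _ sumB) GRing.sumr_const GRing.mulNrn => /eqP.
  rewrite -(prednK (n := #|PP|)) ?card_gt0 // GRing.mulrS GRing.opprD.
  by rewrite GRing.addNKr GRing.oppr_eq0 => /eqP.
apply/trivgP/subsetP=> a Aa; apply/set1gP/eqP.
have aPP: #[a] %| #|PP|.-1.
  rewrite order_dvdn; have /(congr1 val) := kill (fmod abA a).
  by rewrite fmvalZ fmodK // => ->.
by rewrite -order_eq1 -dvdn1 -(eqP coA) dvdn_gcd order_dvdG.
Qed.

(** A Frobenius group is partitioned by its kernel K and the #|K| conjugates of
    its complement. *)
Lemma Frobenius_fixpoint A G K H :
    abelian A -> G \subset 'N(A) -> [Frobenius G = K ><| H] ->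
    'C_A(K) = 1 -> 'C_A(H) = 1 -> coprime #|A| #|K| ->
  A :=: 1.
Proof.
move=> abA nAG frobG tiAK tiAH coAK.
have [defG ntK ntH _ _] := Frobenius_context frobG.
have [nsKG sHG _ nKH tiKH] := sdprod_context defG; have [sKG nKG] := andP nsKG.
have [_ _ tiHG] := normedTI_memJ_P (andP (FrobeniusWcompl frobG)).2.
have K'HK : gval K \notin H :^: K.
  apply/imsetP=> [[k Kk defK]]; case/eqP: ntK; rewrite -tiKH.
  apply/esym/setIidPl.
  by rewrite -(conjSg _ _ k) conjGid // defK.
(* The complement H meets its conjugates by nontrivial k in K trivially. *)
have cardHK : #|H :^: K| = #|K|.
  rewrite card_conjugates (_ : 'N_K(H) = 1) ?indexg1 //.
  apply/trivgP; rewrite -tiKH; apply/subsetP=> k /setIP[Kk nHk].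
  rewrite inE Kk; have [h Hh nth] := trivgPn _ ntH.
  by rewrite -(tiHG h k) ?(subsetP sKG) // !inE ?conjg_eq1 ?nth ?memJ_norm.
apply: (partitioned_group_fixpoint (PP := gval K |: H :^: K) abA nAG) => //.
- move=> B /setU1P[-> | /imsetP[k Kk ->]]; first by rewrite groupP.
  have Gk := subsetP sKG k Kk.
  split; first exact: groupP (H :^ k)%G.
    by rewrite -(conjGid Gk) conjSg.
  by rewrite centJ -{1}(normsP nAG k Gk) -conjIg tiAH conjs1g.
- move=> x /setD1P[ntx Gx].
  have /and3P[/eqP covG /trivIsetP tiG _] := Frobenius_partition frobG.
  have tiKHk k : k \in K -> x \in K -> x \in H :^ k -> false.
    move=> Kk Kx Hkx; case/negP: ntx; rewrite -in_set1 -[[set _]](conjs1g k).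
    by rewrite -tiKH conjIg conjGid // inE Kx.
  suffices [B PPB uniqB] :
      exists2 B : {set gT}, B \in gval K |: H :^: K
        & x \in B /\ forall k, k \in K -> x \in H :^ k -> H :^ k = B.
    apply/eqP/cards1P; exists B; apply/setP=> C; rewrite inE in_set1.
    case: uniqB => Bx uniqB; apply/andP/eqP=> [[/setU1P[->|HC] Cx] | -> //].
      case/setU1P: PPB Bx => [-> //| /imsetP[k Kk ->]] Hkx.
      by case/negP: (tiKHk k Kk Cx Hkx).
    by case/imsetP: HC => k Kk defC; rewrite defC uniqB -?defC.
  have: x \in cover (gval K |: H^# :^: K) by rewrite covG.
  case/bigcupP=> _ /setU1P[-> Kx | /imsetP[k Kk ->] Hkx].
    by exists (gval K); rewrite ?setU11 //; split=> // k Kk /(tiKHk k Kk Kx).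
  have Hx : x \in H :^ k by move: Hkx; rewrite conjD1g => /setD1P[].
  exists (H :^ k); first by rewrite !inE imset_f ?orbT.
  split=> // k' Kk' Hk'x; rewrite -(setD1K (group1 (H :^ k)%G)).
  rewrite -(setD1K (group1 (H :^ k')%G)) /= -!conjD1g; congr (_ |: _).
  apply: contraTeq isT => /tiG/pred0P.
  have Pk j : j \in K -> H^# :^ j \in gval K |: H^# :^: K.
    by move=> Kj; rewrite !inE imset_f ?orbT.
  by case/(_ (Pk _ Kk') (Pk _ Kk))/(_ x); rewrite /= Hkx conjD1g !inE ntx Hk'x.
- by apply/set0Pn; exists (gval K); rewrite setU11.
by rewrite cardsU1 K'HK cardHK.
Qed.

(** An elementary abelian group of order t ^ 2 is partitioned by its t + 1
    subgroups of order t. *)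
Lemma abelem_fixpoint A E (t : nat) :
    abelian A -> E \subset 'N(A) -> t.-abelem E -> logn t #|E| = 2 ->
    semiregular A E -> coprime #|A| t ->
  A :=: 1.
Proof.
move=> abA nAE abelE dimE regAE coAt.
have E2E : E \in 'E_t^2(E) by rewrite !inE subxx abelE dimE.
have t_pr := pnElem_prime E2E.
have card1 := card_p1Elem_p2Elem E2E.
pose f (B : {group gT}) : {set gT} := gval B.
have inj_f : injective f by exact: group_inj.
apply: (partitioned_group_fixpoint (PP := f @: 'E_t^1(E)) abA nAE) => //.
- move=> _ /imsetP[B E1B ->]; rewrite groupP; split=> //.
    by have [] := pnElemP E1B.
  have [sBE _ dimB] := pnElemP E1B.
  have [|x Bx ntx] := trivgPn B _.
    by apply/eqP=> B1; rewrite B1 cards1 logn1 in dimB.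
  apply/trivgP; rewrite -(regAE x); last by rewrite !inE ntx (subsetP sBE).
  by rewrite setIS // -cent_cycle centS ?cycle_subG.
- move=> x /setD1P[ntx Ex]; apply/eqP/cards1P; exists <[x]>.
  have ox : #[x] = t by apply: abelem_order_p abelE Ex ntx.
  have E1x : <[x]>%G \in 'E_t^1(E).
    apply/pnElemP; rewrite cycle_subG Ex (abelemS _ abelE) ?cycle_subG //=.
    by rewrite -orderE ox logn_prime ?eqxx.
  apply/setP=> B; rewrite !inE; apply/andP/eqP=> [[/imsetP[D E1D ->] Dx] | ->].
    apply/eqP; rewrite eq_sym eqEcard cycle_subG Dx -[#|<[x]>|]/#[x] ox.
    by rewrite /f (card_pnElem E1D) expn1 leqnn.
  by rewrite cycle_id; split=> //; apply/imsetP; exists <[x]>%G.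
- by rewrite -card_gt0 card_imset // card1.
by rewrite card_imset // card1.
Qed.

End FixedPoints.

(** * Groups whose elements all have prime power order *)

Section PrimePowerOrder.

Variable gT : finGroupType.
Implicit Types G H K E : {group gT}.

Lemma prime_power_order_commute (x y : gT) :
    prime_power_order (x * y) -> commute x y -> coprime #[x] #[y] ->
  x != 1 -> y = 1.
Proof.
case=> r [k [r_pr oxy]] cxy co_xy ntx; move: oxy; rewrite orderM // => oxy.
have [rx ry] : r.-nat #[x] /\ r.-nat #[y].
  by apply/andP; rewrite -pnatM oxy pnatX pnat_id.
have [[|i] ox] := p_natP rx; first by rewrite -order_eq1 ox in ntx.
move: co_xy; rewrite ox coprime_pexpl // => co_ry.
apply/eqP; rewrite -order_eq1; apply/eqP/(pnat_1 ry).
by rewrite p'natE // -prime_coprime.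
Qed.

Lemma p_elt_prime_power_order (t : nat) (x : gT) :
  prime_power_order x -> prime t -> t %| #[x] -> t.-elt x.
Proof.
case=> r [k [r_pr ox]] t_pr; rewrite /p_elt ox Euclid_dvdX //.
by case/andP; rewrite dvdn_prime2 // => /eqP -> _; rewrite pnatX pnat_id.
Qed.

Lemma prime_power_order_coset K (x : gT) :
  prime_power_order x -> prime_power_order (coset K x).
Proof.
case=> r [k [r_pr ox]]; exists r.
have : #[coset K x] %| r ^ k.
  have [nKx | nKx] := boolP (x \in 'N(K)); first by rewrite -ox morph_order.
  by rewrite coset_default ?(negPf nKx) // order1 dvd1n.
by case/(dvdn_pfactor _ _ r_pr)=> m _ ox'; exists m.
Qed.

Lemma pgroup_elt (s : nat_pred) G : {in G, forall x, s.-elt x} -> s.-group G.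
Proof.
move=> sG; apply/pgroupP=> r r_pr /(Cauchy r_pr)[x Gx ox].
by have := sG x Gx; rewrite /p_elt ox pnatE.
Qed.

Definition EPPO (rT : finGroupType) (G : {group rT}) :=
  {in G, forall x, prime_power_order x}.

Lemma EPPO_quotient G K : EPPO G -> EPPO (G / K).
Proof.
move=> ppoG _ /morphimP[x _ Gx ->]; exact/prime_power_order_coset/ppoG.
Qed.

(** If y commutes with the s-element x, then x * y.`_s^' has order
    #[x] * #[y.`_s^'], a product of coprime factors. *)
Lemma EPPO_cent1 G (s : nat_pred) x :
  EPPO G -> x \in G -> s.-elt x -> x != 1 -> {in 'C_G[x], forall y, s.-elt y}.
Proof.
move=> ppoG Gx s_x ntx y /setIP[Gy /cent1P/commute_sym cxy].
have cxy' : commute x y.`_s^' by apply: commuteX.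
have Gxy : x * y.`_s^' \in G by rewrite groupM ?groupX.
have := prime_power_order_commute (ppoG _ Gxy) cxy' _ ntx.
rewrite (pnat_coprime s_x (p_elt_constt _ _)) => /(_ isT)/constt1P.
by rewrite /p_elt (eq_pnat _ (negnK s)).
Qed.

(** Centralizers of nontrivial elements of K consist of s-elements, and a normal
    Hall s-subgroup contains all of these. *)
Lemma EPPO_Frobenius_kernel G K (s : nat_pred) :
    EPPO G -> s.-Hall(G) K -> K <| G -> K :!=: 1 -> K \proper G ->
  [Frobenius G with kernel K].
Proof.
move=> ppoG hallK nsKG ntK prKG; apply/Frobenius_kerP; split=> // x.
case/setD1P=> ntx Kx; apply/subsetP=> y Cxy; have [Gy _] := setIP Cxy.
rewrite (mem_normal_Hall hallK) //.
have Gx := subsetP (proper_sub prKG) x Kx.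
exact: EPPO_cent1 ppoG Gx (mem_p_elt (pHall_pgroup hallK) Kx) ntx y Cxy.
Qed.

Lemma EPPO_pgroup_center G x (s : nat_pred) :
  EPPO G -> x \in 'Z(G) -> s.-elt x -> x != 1 -> s.-group G.
Proof.
move=> ppoG /centerP[Gx cGx] s_x ntx; apply: pgroup_elt => y Gy.
apply: (EPPO_cent1 ppoG Gx s_x ntx); rewrite inE Gy.
by apply/cent1P; symmetry; apply: cGx.
Qed.

Lemma pHall_normal_pgroup_quotient G K (s t : nat) :
  s.-group K -> K <| G -> t.-group (G / K) -> t != s -> s.-Hall(G) K.
Proof.
move=> sK /andP[sKG nKG] tGK neq_ts; rewrite /pHall sKG sK -card_quotient //=.
by apply: sub_in_pnat tGK => r _ /eqnP->; rewrite !inE.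
Qed.

Lemma solvable_pcore_neq1 G :
  solvable G -> G :!=: 1 -> exists2 s : nat, prime s & 'O_s(G) != 1.
Proof.
move=> solG ntG.
have [A [_ nsAG ntA /is_abelemP[s s_pr abelA]]] :=
  solvable_norm_abelem solG (normal_refl G) ntG.
exists s => //; apply: contra ntA; rewrite -!subG1; apply: subset_trans.
exact: pcore_max (abelem_pgroup abelA) nsAG.
Qed.

(** Nilpotency of K serves to have a nontrivial abelian group, 'Z(K), on which a
    subgroup of H of type (t, t) would act without nontrivial fixed points. *)
Lemma Frobenius_compl_p_rank G K H (t : nat) :
  [Frobenius G = K ><| H] -> nilpotent K -> 'r_t(H) <= 1.
Proof.
move=> frobG nilK; rewrite leqNgt; apply/p_rank_geP=> [[E E2H]].
have [defG ntK _ _ _] := Frobenius_context frobG.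
have [_ _ nKH _] := sdprodP defG; have [sEH abelE dimE] := pnElemP E2H.
have coKH := Frobenius_coprime frobG.
case/eqP: ntK; apply/eqP; rewrite -(center_nil_eq1 nilK); apply/eqP.
apply: (abelem_fixpoint (E := E) (t := t)) => //.
- exact: center_abelian.
- by rewrite (subset_trans sEH) // (char_norm_trans (center_char K)).
- exact: semiregularS (center_sub K) sEH (Frobenius_reg_ker frobG).
apply: coprimeSg (center_sub K) _; apply: coprime_dvdr coKH.
apply: dvdn_trans (cardSg sEH).
by rewrite (card_pnElem E2H) expnS dvdn_mulr.
Qed.

End PrimePowerOrder.

(** * Structure of the solvable EPPO groups *)

(** With Q = 'O_t(G), an s-element y acts on Q without nontrivial fixed points,
    which forces t to be odd and hence Q to be cyclic. Since 'C_G(Q) is a normal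
    t-subgroup it lies in Q, so G / Q is a quotient of G / 'C_G(Q), which embeds
    in the abelian group Aut Q; as G / Q contains the image of y, it is an
    s-group. *)
Lemma EPPO_pcore_rank1_Frobenius (gT : finGroupType) (G : {group gT})
    (s t : nat) :
    EPPO G -> prime s -> prime t -> s != t -> s %| #|G| ->
    'O_t(G) != 1 -> 'r_t('O_t(G)) <= 1 ->
  [Frobenius G with kernel 'O_t(G)].
Proof.
move=> ppoG s_pr t_pr neq_st s_dv_G ntQ rQ; set Q := 'O_t(G)%G.
have tQ : t.-group Q := pcore_pgroup t G.
have nsQG : Q <| G := pcore_normal t G; have [sQG nQG] := andP nsQG.
have [y Gy oy] := Cauchy s_pr s_dv_G.
have s_y : s.-elt y by rewrite /p_elt oy pnat_id.
have nty : y != 1 by rewrite -order_eq1 oy neq_ltn prime_gt1 ?orbT.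
have t'y x : t.-elt x -> x \in G -> x != 1 -> ~ commute x y.
  move=> t_x Gx ntx cxy.
  have := EPPO_cent1 ppoG Gx t_x ntx; move/(_ y); rewrite inE Gy /=.
  move/(_ (introT cent1P (commute_sym cxy))).
  by rewrite /p_elt oy pnatE //= inE (negPf neq_st).
(* For t = 2, the rank bound leaves a single involution z in 'Z(Q), which y
   must fix. *)
have odd_t : odd t.
  have [//|] := even_prime t_pr; last by [].
  move=> t2; exfalso; set Z := 'Ohm_1('Z(Q))%G.
  have sZQ : Z \subset Q by rewrite (subset_trans (Ohm_sub 1 _)) ?center_sub.
  have tZQ : t.-group 'Z(Q) := pgroupS (center_sub Q) tQ.
  have abelZ : t.-abelem Z by apply: Ohm1_abelem tZQ (center_abelian Q).
  have ntZ : Z :!=: 1 by rewrite Ohm1_eq1 (center_nil_eq1 (pgroup_nil tQ)).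
  have oZ : #|Z| = 2.
    have [_ _ [n oZ]] := pgroup_pdiv (abelem_pgroup abelZ) ntZ.
    have: logn t #|Z| <= 1.
      by rewrite -(p_rank_abelem abelZ) (leq_trans (p_rankS t sZQ)).
    by rewrite oZ pfactorK // t2; case: (n).
  have [z Zz ntz] := trivgPn Z ntZ.
  have oz : #[z] = 2 by rewrite -t2; apply: abelem_order_p abelZ Zz ntz.
  have defZ : Z :=: [set 1; z].
    rewrite -cycle2g //; apply/esym/eqP.
    by rewrite eqEcard cycle_subG Zz oZ -oz /=.
  have nZG : G \subset 'N(Z).
    exact: char_norm_trans (Ohm_char 1 _) (char_norm_trans (center_char Q) nQG).
  have Qz := subsetP sZQ z Zz.
  case: (t'y z) => //; [exact: mem_p_elt tQ Qz | exact: subsetP sQG z Qz |].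
  apply/commgP/conjg_fixP/set1P.
  have: z ^ y \in Z by rewrite memJ_norm ?(subsetP nZG).
  by rewrite defZ !inE conjg_eq1 (negPf ntz).
have cycQ : cyclic Q.
  rewrite (odd_pgroup_rank1_cyclic tQ) //.
  by have [n ->] := p_natP tQ; rewrite oddX odd_t orbT.
(* The centralizer of Q centralizes a nontrivial t-element of G. *)
have sCQ : 'C_G(Q) \subset Q.
  apply: pcore_max; last by rewrite /normal subsetIl normsI ?normG ?norms_cent.
  have [x Qx ntx] := trivgPn Q ntQ; apply: pgroup_elt => z /setIP[Gz cQz].
  apply: (EPPO_cent1 ppoG (subsetP sQG x Qx) (mem_p_elt tQ Qx) ntx).
  by rewrite inE Gz; apply/cent1P/(centP cQz).
have abGQ : abelian (G / Q).
  rewrite sub_der1_abelian // (subset_trans _ sCQ) // subsetI der_sub /=.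
  rewrite -ker_conj_aut ker_trivg_morphim (subset_trans (der_sub 1 G) nQG) /=.
  rewrite (morphim_der (conj_aut_morphism Q)) // subG1; apply/eqP/derG1P.
  exact: abelianS (Aut_conj_aut _ _) (Aut_cyclic_abelian cycQ).
have nQy : y \in 'N(Q) := subsetP nQG y Gy.
have Q'y : y \notin Q.
  apply: contra nty => Qy; have := mem_p_elt tQ Qy.
  by rewrite /p_elt oy pnatE //= inE (negPf neq_st).
have s_GQ : s.-group (G / Q).
  apply: (EPPO_pgroup_center (x := coset Q y)).
  - exact: EPPO_quotient.
  - by rewrite (center_idP abGQ) mem_quotient.
  - exact: morph_p_elt.
  by apply: contra Q'y => /eqP/coset_idr->.
have prQG : Q \proper G by apply/properP; split=> //; exists y.
apply: (EPPO_Frobenius_kernel (s := t)) => //.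
exact: pHall_normal_pgroup_quotient tQ nsQG s_GQ neq_st.
Qed.

(** Higman's description of the solvable EPPO groups. If G / 'O_s(G) is an
    s'-group then G is Frobenius; otherwise the preimage L of a nontrivial
    t-core of G / 'O_s(G) provides the 2-Frobenius series. *)
Theorem solvable_EPPO_Frobenius (gT : finGroupType) (G : {group gT}) :
    solvable G -> EPPO G -> (forall s, prime s -> ~~ s.-group G) ->
  [Frobenius G] \/ two_Frobenius G.
Proof.
move=> solG ppoG notpG.
(* The trivial group is an s-group for every s; 2 stands for any prime. *)
have ntG : G :!=: 1 by apply: contraNneq (notpG 2 isT) => ->; apply: pgroup1.
have [s s_pr ntK] := solvable_pcore_neq1 solG ntG.
set K := 'O_s(G)%G in ntK.
have sK : s.-group K := pcore_pgroup s G.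
have nsKG : K <| G := pcore_normal s G; have [sKG nKG] := andP nsKG.
have [s'GK | ] := boolP (s^'.-group (G / K)).
  left; suffices: [Frobenius G with kernel K].
    by case/existsP=> H /FrobeniusW.
  have hallK : s.-Hall(G) K by rewrite /pHall sKG sK -card_quotient.
  apply: EPPO_Frobenius_kernel ppoG hallK nsKG ntK _.
  rewrite properEneq sKG andbT; apply: contraNneq (notpG s s_pr) => /= <-.
  exact: sK.
rewrite /pgroup p'natE // negbK => s_dv_GK; right.
have ntGK : G / K != 1.
  by apply: contraTneq s_dv_GK => ->; rewrite cards1 Euclid_dvd1.
have [t t_pr ntQ] := solvable_pcore_neq1 (quotient_sol K solG) ntGK.
have neq_ts : t != s.
  apply: contraNneq ntQ => ->; exact/eqP/trivg_pcore_quotient.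
have [L defQ sKL nsLG] := inv_quotientN nsKG (pcore_normal t (G / K)).
have sLG := normal_sub nsLG.
have nsKL : K <| L := normalS sKL sLG nsKG.
have tLK : t.-group (L / K) by rewrite -defQ pcore_pgroup.
have frobL : [Frobenius L with kernel K].
  apply: (EPPO_Frobenius_kernel (sub_in1 (subsetP sLG) ppoG) _ nsKL ntK).
    exact: pHall_normal_pgroup_quotient sK nsKL tLK neq_ts.
  rewrite properEneq sKL andbT; apply: contraNneq ntQ => eqKL.
  by rewrite /= defQ -eqKL trivg_quotient.
have rQ : 'r_t('O_t(G / K)) <= 1.
  have [H frobLH] := existsP frobL.
  have [defL _ _ _ _] := Frobenius_context frobLH.
  rewrite /= defQ -(isog_p_rank (sdprod_isog defL)).
  exact: Frobenius_compl_p_rank frobLH (pgroup_nil sK).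
have frobGK : [Frobenius G / K with kernel L / K].
  rewrite -defQ; apply: (EPPO_pcore_rank1_Frobenius (s := s)) => //.
    exact: EPPO_quotient.
  by rewrite eq_sym.
exists K, L; split=> //; split=> //.
  by have [_] := Frobenius_kerP frobL.
have [_ prLG _ _] := Frobenius_kerP frobGK.
rewrite properEneq sLG andbT.
by apply: contraTneq prLG => /= ->; rewrite properxx.
Qed.

(** * Primes dividing the order of the normal subgroup *)

Section Outside.

Variable gT : finGroupType.
Implicit Types G N R V P : {group gT}.

(** The product x * y lies outside N together with x, so its order is a power of
    a prime. *)
Lemma cent1_outside G N (x y : gT) :
    {in G :\: N, forall z, prime_power_order z} -> N \subset G ->
    x \in G :\: N -> y \in N -> commute x y -> coprime #[x] #[y] -> y = 1.
Proof.
move=> ppoN sNG /setDP[Gx nNx] Ny cxy coxy.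
apply: prime_power_order_commute _ cxy coxy _.
  by apply: ppoN; rewrite inE groupMr // nNx groupM // (subsetP sNG).
by apply: contraNneq nNx => ->.
Qed.

(** An element b of G of order t modulo N factors as v * x with v in V and x in
    'N_G(P). Modulo V the elements x and b agree and have order t, so x is a
    t-element by the hypothesis on elements outside N. Since V / N is an
    s-group, the t-element x ^+ t of V lies in N. *)
Lemma Frattini_outside G N V P (s t : nat) :
    N <| G -> V <| G -> N \subset V -> s.-group (V / N) -> s.-Sylow(V) P ->
    {in G :\: N, forall x, prime_power_order x} ->
    prime t -> t != s -> t %| #|G / N| ->
  exists x, [/\ x \in 'N_G(P), x \notin V, t.-elt x & x ^+ t \in N].
Proof.
move=> nsNG nsVG sNV sVN sylP ppoN t_pr neq_ts t_dv_GN.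
have [sNG nNG] := andP nsNG; have [sVG nVG] := andP nsVG.
have tVN z : z \in V -> t.-elt z -> z \in N.
  move=> Vz t_z; have nNz := subsetP nNG z (subsetP sVG z Vz).
  apply: coset_idr => //; apply/eqP; rewrite -order_eq1; apply/eqP.
  apply: (@pnat_1 s); first exact: mem_p_elt sVN (mem_quotient N Vz).
  apply: sub_in_pnat (morph_p_elt (coset_morphism N) nNz t_z) => i _ /eqnP->.
  by rewrite !inE.
have [_ /morphimP[b nNb Gb ->] ob] := Cauchy t_pr t_dv_GN.
have nVb : b \notin V.
  apply: contraL isT => Vb; have := mem_p_elt sVN (mem_quotient N Vb).
  by rewrite /p_elt ob pnatE // inE (negPf neq_ts).
have Nbt : b ^+ t \in N.
  by apply: coset_idr; rewrite ?groupX // morphX //= -ob expg_order.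
have: b \in V * 'N_G(P) by rewrite (Frattini_arg nsVG sylP).
case/mulsgP=> v x Vv NGPx def_b; have [Gx nPx] := setIP NGPx.
have nVx : x \notin V by apply: contra nVb => Vx; rewrite def_b groupM.
have [nVGx nVGv] := (subsetP nVG x Gx, subsetP (normG V) v Vv).
have xbV : coset V x = coset V b.
  by rewrite def_b morphM //= (coset_id Vv) mul1g.
have Vxt : x ^+ t \in V.
  apply: coset_idr; first by rewrite groupX.
  rewrite morphX //= xbV -morphX ?(subsetP nVG) //= coset_id //.
  exact: subsetP sNV _ Nbt.
have t_x : t.-elt x.
  apply: p_elt_prime_power_order => //.
    by apply: ppoN; rewrite inE Gx andbT; apply: contra nVx => /(subsetP sNV).
  have <-: #[coset V x] = t; last exact: morph_order nVGx.
  apply: nt_prime_order => //; first by rewrite -morphX //= coset_id.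
  by apply: contra nVx => /eqP/coset_idr->.
exists x; split=> //; apply: tVN Vxt _; exact: mem_p_elt t_x (mem_cycle x t).
Qed.

(** A Sylow s-subgroup P of the preimage of 'O_s(G / N) and the element x
    provided by [Frattini_outside] generate a Frobenius group. The delicate
    point is that x has order exactly t: as x ^+ t lies in N it centralizes
    P / (P :&: N), so by coprime action it centralizes an element of P outside
    N, which is possible only if x ^+ t = 1. *)
Theorem normal_pgroup_outside_trivial G N R (r : nat) :
    N <| G -> R <| G -> R \subset N -> r.-group R ->
    {in G :\: N, forall x, prime_power_order x} ->
    {in G :\: N, forall x, r^'.-elt x} ->
    solvable (G / N) -> (forall s, prime s -> ~~ s.-group (G / N)) ->
  R :=: 1.
Proof.
move=> nsNG nsRG sRN rR ppoN r'N solGN notpGN.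
have [sNG nNG] := andP nsNG; have [sRG nRG] := andP nsRG.
have ntGN : G / N != 1.
  by apply: contraNneq (notpGN 2 isT) => ->; apply: pgroup1.
have [s s_pr ntO] := solvable_pcore_neq1 solGN ntGN.
have [t t_pr [t_dv_GN neq_ts]] :
    exists2 t, prime t & t %| #|G / N| /\ t != s.
  have := notpGN s s_pr; rewrite /pgroup /pnat cardG_gt0 /=.
  case/allPn=> t; rewrite mem_primes => /and3P[t_pr _ t_dv] neq_ts.
  by exists t.
have [V defO sNV nsVG] := inv_quotientN nsNG (pcore_normal s (G / N)).
have sVG := normal_sub nsVG.
have sVN : s.-group (V / N) by rewrite -defO pcore_pgroup.
have [P sylP] := Sylow_exists s V; have [sPV sP _] := and3P sylP.
have nNP : P \subset 'N(N) := subset_trans (subset_trans sPV sVG) nNG.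
have not_sPN : ~~ (P \subset N).
  apply: contra ntO => sPN; rewrite /= defO.
  by have /= <- := pHall_id (quotient_pHall nNP sylP) sVN; rewrite quotientS1.
have [x [/setIP[Gx nPx] nVx t_x Nxt]] :=
  Frattini_outside nsNG nsVG sNV sVN sylP ppoN t_pr neq_ts t_dv_GN.
have outP y : y \in P -> y \notin N -> y \in G :\: N.
  by move=> Py nNy; rewrite inE nNy (subsetP sVG) // (subsetP sPV).
have st_co (z : gT) : t.-elt z -> coprime #|P| #[z].
  move=> t_z; apply: pnat_coprime sP _.
  by apply: sub_in_pnat t_z => i _ /eqnP->; rewrite !inE.
have xt1 : x ^+ t = 1.
  set A := <[x ^+ t]>%G.
  have sAN : A \subset N by rewrite cycle_subG.
  have nPA : A \subset 'N(P) by rewrite cycle_subG groupX.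
  have coPA : coprime #|P| #|A| := st_co _ (mem_p_elt t_x (mem_cycle x t)).
  have nHA : A \subset 'N(P :&: N).
    by rewrite normsI // (subset_trans sAN) ?normG.
  have nHP : P \subset 'N(P :&: N) by rewrite normsI ?normG.
  (* The commutators lie in P, which A normalizes, and in N, which contains A
     and is normalized by P. *)
  have cPA : A / (P :&: N) \subset 'C(P / (P :&: N)).
    rewrite quotient_cents2 // subsetI commg_subr nPA.
    by rewrite (subset_trans (commSg P sAN)) // commg_subl.
  have := coprime_quotient_cent (subsetIl P N) nHA coPA (pgroup_sol sP).
  rewrite [RHS](setIidPl _) 1?centsC // => defCP.
  have [sCN | /subsetPn[y /setIP[Py cAy] nNy]] := boolP ('C_P(A) \subset N).
    case/negP: not_sPN; apply: subset_trans (subsetIr P N).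
    rewrite -quotient_sub1 // -defCP quotient_sub1 ?subsetI ?subsetIl //.
    by rewrite (subset_trans (subsetIl _ _)).
  apply: (cent1_outside ppoN sNG (outP y Py nNy) Nxt).
    exact: centP cAy _ (cycle_id _).
  exact: coprime_dvdl (order_dvdG Py) coPA.
have ox : #[x] = t.
  apply: nt_prime_order => //; apply: contraNneq nVx => ->; exact: group1.
have tiPx : 'C_P[x] = 1.
  apply/trivgP/subsetP=> y /setIP[Py /cent1P cxy]; apply/set1gP.
  apply: (prime_power_order_commute (x := x)).
  - have Gy := subsetP sVG y (subsetP sPV y Py).
    apply: ppoN; rewrite inE (groupM Gx Gy) andbT.
    apply: contra nVx => /(subsetP sNV).
    by rewrite (groupMr _ (subsetP sPV y Py)).
  - exact: commute_sym.
  - by rewrite coprime_sym (coprime_dvdl (order_dvdG Py)) ?st_co.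
  by apply: contraNneq nVx => ->; exact: group1.
have ntP : P :!=: 1 by apply: contraNneq not_sPN => ->; apply: sub1G.
have frobPx : [Frobenius P <*> <[x]> = P ><| <[x]>].
  apply/prime_FrobeniusP => //; first by rewrite -orderE ox.
  rewrite cent_cycle tiPx; split=> //; rewrite sdprodEY ?cycle_subG //.
  by apply/coprime_TIg/st_co.
(* Commuting elements y outside N and a in R have coprime orders. *)
have regR y : y \in G :\: N -> 'C_R[y] = 1.
  move=> GNy; apply/trivgP/subsetP=> a /setIP[Ra /cent1P cya]; apply/set1gP.
  apply: (cent1_outside ppoN sNG GNy (subsetP sRN a Ra)).
    exact: commute_sym.
  by rewrite coprime_sym (pnat_coprime (mem_p_elt rR Ra) (r'N y GNy)).
have [y Py nNy] := subsetPn not_sPN.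
apply/eqP; rewrite -(center_nil_eq1 (pgroup_nil rR)); apply/eqP.
have tiZ z (A : {set gT}) : z \in G :\: N -> z \in A -> 'C_('Z(R))(A) = 1.
  move=> GNz Az; apply/trivgP; rewrite -(regR z GNz) setISS ?center_sub //.
  by rewrite -cent_set1 centS // sub1set.
apply: (Frobenius_fixpoint (center_abelian R) _ frobPx).
- apply: subset_trans (char_norm_trans (center_char R) nRG).
  by rewrite join_subG (subset_trans sPV) // cycle_subG.
- exact: tiZ (outP y Py nNy) Py.
- apply: tiZ (cycle_id x); rewrite inE Gx andbT.
  by apply: contra nVx; apply: subsetP.
apply: (pnat_coprime (pgroupS (center_sub R) rR)).
have := r'N y (outP y Py nNy); have := mem_p_elt sP Py.
have nty : y != 1 by apply: contraNneq nNy => ->; apply: group1.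
case/p_natP=> [[|i] oy]; first by rewrite -order_eq1 oy in nty.
rewrite /p_elt oy pnatX orbF pnatE // => r's.
by apply: sub_in_pnat sP => j _ /eqnP->.
Qed.

(** For R Sylow in N, the pair 'N_G(R), 'N_N(R) inherits the hypotheses on G, N
    and has an isomorphic quotient, by the Frattini argument. *)
Lemma prime_dvd_normal_outside G N (r : nat) :
    N <| G -> {in G :\: N, forall x, prime_power_order x} ->
    solvable (G / N) -> (forall s, prime s -> ~~ s.-group (G / N)) ->
    prime r -> r %| #|N| ->
  exists2 x, x \in G :\: N & r %| #[x].
Proof.
move=> nsNG ppoN solGN notpGN r_pr r_dv_N.
apply/exists_inP; apply: contraLR r_dv_N => noN.
have r'N x : x \in G :\: N -> r^'.-elt x.
  move=> GNx; rewrite /p_elt p'natE //; apply: contra noN => r_dv_x.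
  by apply/exists_inP; exists x.
have [sNG nNG] := andP nsNG; have [R sylR] := Sylow_exists r N.
have [sRN rR _] := and3P sylR; set M := 'N_G(R)%G.
have sMG : M \subset G := subsetIl G _.
have nsMN : N :&: M <| M.
  by rewrite /normal subsetIr normsI ?normG // (subset_trans sMG).
have sRM : R \subset M by rewrite subsetI normG (subset_trans sRN).
have nsRM : R <| M by rewrite /normal sRM subsetIr.
have isoM : M / (N :&: M) \isog G / N.
  rewrite -(Frattini_arg nsNG sylR) quotientMidl.
  exact: second_isog (subset_trans sMG nNG).
have sub_out : {subset M :\: (N :&: M) <= G :\: N}.
  move=> x; rewrite !inE => /andP[nNMx /andP[Gx nRx]].
  by move: nNMx; rewrite Gx nRx !andbT => ->.
have R1 : R :=: 1.
  apply: (normal_pgroup_outside_trivial nsMN nsRM) rR _ _ _ _.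
  - by rewrite subsetI sRN.
  - by move=> x /sub_out; apply: ppoN.
  - by move=> x /sub_out; apply: r'N.
  - by rewrite (isog_sol isoM).
  by move=> s s_pr; rewrite (isog_pgroup _ isoM) notpGN.
by rewrite -p'natE // -partn_eq1 // -(card_Hall sylR) R1 cards1.
Qed.

End Outside.

(** * Prime power orders outside a normal subgroup *)

Theorem theorem1p2 (gT : finGroupType) (G N : {group gT}) (nsNG : N <| G)
    (primepow : forall x : gT, x \in G :\: N -> prime_power_order x)
    (p q : nat) (p_pr : prime p) (q_pr : prime q) (neq_pq : p <> q)
    (primes_outside : forall r : nat, prime r ->
       (exists2 x : gT, x \in G :\: N & r %| #[x]) <-> r = p \/ r = q) :
  (pred2 p q : nat_pred).-group G /\
  ([Frobenius G / N] \/ two_Frobenius (G / N)).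
Proof.
have [sNG nNG] := andP nsNG.
have dvd_quo r : prime r -> r = p \/ r = q -> r %| #|G / N|.
  move=> r_pr /(primes_outside _ r_pr)[x GNx r_dv_x].
  have [Gx nNx] := setDP GNx.
  have nNGx := subsetP nNG x Gx.
  have r_x := p_elt_prime_power_order (primepow x GNx) r_pr r_dv_x.
  have [[|i] ox] := p_natP (morph_p_elt (coset_morphism N) nNGx r_x).
    case/negP: nNx; apply: coset_idr nNGx _.
    by apply/eqP; rewrite -order_eq1 ox.
  apply: dvdn_trans (order_dvdG (mem_quotient N Gx)).
  by rewrite /= in ox; rewrite ox expnS dvdn_mulr.
have quo_dvd r : prime r -> r %| #|G / N| -> r \in pred2 p q.
  move=> r_pr /(Cauchy r_pr)[_ /morphimP[x nNx Gx ->] ox].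
  have: exists2 x, x \in G :\: N & r %| #[x].
    exists x; last by rewrite -ox morph_order.
    rewrite inE Gx andbT; apply: contraTN (prime_gt1 r_pr) => Nx.
    by rewrite -ox /= coset_id // order1.
  by case/(primes_outside r r_pr)=> ->; rewrite inE eqxx ?orbT.
have solGN : solvable (G / N).
  apply: Burnside_p_a_q_b.
  apply: (@uniq_leq_size _ _ [:: p; q]) (primes_uniq _) _.
  move=> r; rewrite mem_primes => /and3P[r_pr _ /(quo_dvd r r_pr)].
  by rewrite !inE.
have notpGN s : prime s -> ~~ s.-group (G / N).
  move=> s_pr; apply/negP=> /pgroupP sGN; case: neq_pq.
  have /eqnP-> := sGN p p_pr (dvd_quo p p_pr (or_introl erefl)).
  by have /eqnP-> := sGN q q_pr (dvd_quo q q_pr (or_intror erefl)).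
split.
  apply/pgroupP=> r r_pr.
  rewrite -(Lagrange sNG) -card_quotient // Euclid_dvdM //.
  case/orP=> [r_dv_N | /quo_dvd->//].
  have := prime_dvd_normal_outside nsNG primepow solGN notpGN r_pr r_dv_N.
  by case/(primes_outside r r_pr)=> ->; rewrite inE eqxx ?orbT.
apply: solvable_EPPO_Frobenius => // _ /morphimP[x nNx Gx ->].
have [Nx | nNx'] := boolP (x \in N); last first.
  by apply/prime_power_order_coset/primepow/setDP.
(* The trivial coset has order 2 ^ 0. *)
by exists 2, 0; rewrite /= coset_id // order1.
Qed.
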